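(* Let $(\mathcal X,\mathcal Y)$ be an admissible balanced pair in an abelian category $\mathcal A$. Then the following statements are equivalent for any $M\in\mathcal A$ and any integer $n\ge 0$. (1) $\mathcal X\text{-}\operatorname{res.dim} M\le n$. (2) $\operatorname{Ext}_\ast^{i}(M,N)=0$ for all $i\ge n+1$ and all $N\in\mathcal A$. (3) $\operatorname{Ext}_\ast^{n+1}(M,N)=0$ for all $N\in\mathcal A$. (4) For any $\mathcal X$-resolution $\cdots\to X^{-1}\xrightarrow{d_X^{-1}}X^0\xrightarrow{d_X^0}M\to 0$ of $M$ (with $M$ placed in degree $1$, $d_X^0$ the augmentation and $d_X^1:M\to 0$), one has $\operatorname{Ker} d_X^{-n+1}\in\mathcal X$.
   Context: $\mathcal A$ is an abelian category; a subcategory of $\mathcal A$ means a full additive subcategory closed under isomorphisms and direct summands. A morphism $f:X\to M$ with $X\in\mathcal X$ is a right $\mathcal X$-approximation of $M$ if every morphism $X'\to M$ with $X'\in\mathcal X$ factors through $f$; $\mathcal X$ is contravariantly finite in $\mathcal A$ if every object of $\mathcal A$ has a right $\mathcal X$-approximation. Left approximations and covariantly finite subcategories are defined dually. A complex $A^\bullet$ in $\mathcal A$ is right $\mathcal X$-acyclic if $\operatorname{Hom}_{\mathcal A}(X,A^\bullet)$ is acyclic for all $X\in\mathcal X$, and left $\mathcal X$-acyclic if $\operatorname{Hom}_{\mathcal A}(A^\bullet,X)$ is acyclic for all $X\in\mathcal X$. For $\mathcal X$ contravariantly finite, an $\mathcal X$-resolution of $M$ is a right $\mathcal X$-acyclic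 complex $\cdots\to X^{-1}\to X^0\to M\to 0$ with all $X^i\in\mathcal X$; the complex $X^\bullet=(\cdots\to X^{-1}\to X^0\to 0)$ is the deleted resolution. $\mathcal X\text{-}\operatorname{res.dim}M$ is the minimal $n\ge0$ such that there is an $\mathcal X$-resolution $0\to X^{-n}\to\cdots\to X^0\to M\to0$, and $\infty$ if none exists. For $\mathcal Y$ covariantly finite, a $\mathcal Y$-coresolution of $N$ is a left $\mathcal Y$-acyclic complex $0\to N\to Y^0\to Y^1\to\cdots$ with all $Y^i\in\mathcal Y$. A pair $(\mathcal X,\mathcal Y)$ of subcategories is a balanced pair if $\mathcal X$ is contravariantly finite, $\mathcal Y$ is covariantly finite, every $M\in\mathcal A$ has an $\mathcal X$-resolution that is left $\mathcal Y$-acyclic, and every $N\in\mathcal A$ has a $\mathcal Y$-coresolution that is right $\mathcal X$-acyclic. It is admissible if every right $\mathcal X$-approximation is an epimorphism (equivalently, every left $\mathcal Y$-approximation is a monomorphism). For $M,N\in\mathcal A$ put $\operatorname{Ext}_\ast^i(M,N):=H^i(\operatorname{Hom}_{\mathcal A}(X^\bullet,N))\cong H^i(\operatorname{Hom}_{\mathcal A}(M,Y^\bullet))$, where $X^\bullet\to M$ is an $\mathcal X$-resolution and $N\to Y^\bullet$ a $\mathcal Y$-coresolution (independent of choices). *)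

(* Defs.v *)
From HB Require Import structures.
From mathcomp Require Import all_boot all_algebra.
From mathcomp Require Import ring_quotient boolp.

Set Implicit Arguments.
Unset Strict Implicit.
Unset Printing Implicit Defensive.

Import GRing.Theory.
Local Open Scope ring_scope.

(* Hom-groups are mathcomp zmodTypes; the choice structure that a zmodType
   carries is no restriction, since it exists classically on every type. *)
Record preadditiveCat := PreadditiveCat {
  cat_obj :> Type;
  hom : cat_obj -> cat_obj -> zmodType;
  idm : forall A, hom A A;
  comp : forall A B C, hom B C -> hom A B -> hom A C;
  compA : forall A B C D (h : hom C D) (g : hom B C) (f : hom A B),
    comp h (comp g f) = comp (comp h g) f;
  comp1m : forall A B (f : hom A B), comp (idm B) f = f;
  compm1 : forall A B (f : hom A B), comp f (idm A) = f;
  compDl : forall A B C (g g' : hom B C) (f : hom A B),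
    comp (g + g') f = comp g f + comp g' f;
  compDr : forall A B C (g : hom B C) (f f' : hom A B),
    comp g (f + f') = comp g f + comp g f'
}.

Arguments idm {_} A.
Arguments comp {_ A B C} g f.

Notation "g \oc f" := (comp g f) (at level 40, left associativity).

Section PreadditiveTheory.
Variable A : preadditiveCat.
Implicit Types B C D K : A.

Lemma comp_zmod_morphism_r B C D (g : hom C D) :
  zmod_morphism (fun f : hom B C => g \oc f).
Proof. by move=> f f'; apply/eqP; rewrite eq_sym subr_eq -compDr subrK. Qed.

Lemma comp_zmod_morphism_l B C D (f : hom B C) :
  zmod_morphism (fun g : hom C D => g \oc f).
Proof. by move=> g g'; apply/eqP; rewrite eq_sym subr_eq -compDl subrK. Qed.

Definition postcomp B C D (g : hom C D) (f : hom B C) : hom B D := g \oc f.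
Definition precomp B C D (f : hom B C) (g : hom C D) : hom B D := g \oc f.

HB.instance Definition _ B C D (g : hom C D) :=
  GRing.isZmodMorphism.Build _ _ (@postcomp B C D g) (comp_zmod_morphism_r g).
HB.instance Definition _ B C D (f : hom B C) :=
  GRing.isZmodMorphism.Build _ _ (@precomp B C D f) (comp_zmod_morphism_l f).

Lemma compm0 B C D (g : hom C D) : g \oc (0 : hom B C) = 0.
Proof. exact: (raddf0 (postcomp g)). Qed.

Lemma comp0m B C D (f : hom B C) : (0 : hom C D) \oc f = 0.
Proof. exact: (raddf0 (precomp f)). Qed.

Definition is_zero_obj C :=
  (forall B (f : hom B C), f = 0) /\ (forall B (f : hom C B), f = 0).

Definition mono B C (f : hom B C) :=
  forall D (u v : hom D B), f \oc u = f \oc v -> u = v.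

Definition epi B C (f : hom B C) :=
  forall D (u v : hom C D), u \oc f = v \oc f -> u = v.

Definition is_iso B C (f : hom B C) :=
  exists g : hom C B, g \oc f = idm B /\ f \oc g = idm C.

Definition isomorphic B C := exists f : hom B C, is_iso f.

Definition is_kernel B C (f : hom B C) K (k : hom K B) :=
  f \oc k = 0 /\
  forall D (u : hom D B), f \oc u = 0 -> exists! v : hom D K, k \oc v = u.

Definition is_cokernel B C (f : hom B C) K (q : hom C K) :=
  q \oc f = 0 /\
  forall D (u : hom C D), u \oc f = 0 -> exists! v : hom K D, v \oc q = u.

Definition is_biproduct B C S
    (iB : hom B S) (iC : hom C S) (pB : hom S B) (pC : hom S C) :=
  [/\ pB \oc iB = idm B, pC \oc iC = idm C, pB \oc iC = 0, pC \oc iB = 0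
    & iB \oc pB + iC \oc pC = idm S].

Definition is_direct_sum B C S :=
  exists (iB : hom B S) (iC : hom C S) (pB : hom S B) (pC : hom S C),
    is_biproduct iB iC pB pC.

End PreadditiveTheory.

Record abelianCat := AbelianCat {
  abelian_preadditive :> preadditiveCat;
  zero_obj_ex : exists Z : abelian_preadditive, is_zero_obj Z;
  biproduct_ex : forall B C : abelian_preadditive,
    exists S, is_direct_sum B C S;
  kernel_ex : forall (B C : abelian_preadditive) (f : hom B C),
    exists K (k : hom K B), is_kernel f k;
  cokernel_ex : forall (B C : abelian_preadditive) (f : hom B C),
    exists K (q : hom C K), is_cokernel f q;
  mono_normal : forall (B C : abelian_preadditive) (f : hom B C),
    mono f -> exists D (g : hom C D), is_kernel g f;
  epi_normal : forall (B C : abelian_preadditive) (f : hom B C),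
    epi f -> exists D (g : hom D B), is_cokernel g f
}.

Definition zero_obj (A : abelianCat) : A := projT1 (cid (zero_obj_ex A)).

Definition Ker (A : abelianCat) (B C : A) (f : hom B C) : A :=
  projT1 (cid (kernel_ex f)).

Record subcategory (A : abelianCat) := Subcategory {
  in_subcat :> A -> Prop;
  subcat_zero : forall Z, is_zero_obj Z -> in_subcat Z;
  subcat_sum : forall B C S, is_direct_sum B C S ->
    in_subcat B -> in_subcat C -> in_subcat S;
  subcat_iso : forall B C, isomorphic B C -> in_subcat B -> in_subcat C;
  subcat_summand : forall B C S, is_direct_sum B C S ->
    in_subcat S -> in_subcat B
}.

(* Cochain complexes of abelian groups.  The differential is given between all
   pairs of degrees and vanishes outside the pairs (i, i + 1); this avoids
   transporting along equalities of degrees. *)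
Record zcomplex := ZComplex {
  zterm :> int -> zmodType;
  zdiff : forall i j, {additive zterm i -> zterm j};
  zdiff_shape : forall i j, j != i + 1 -> forall x, zdiff i j x = 0;
  zdiffK : forall i j k x, zdiff j k (zdiff i j x) = 0
}.

Section Cohomology.
Variables (C : zcomplex) (i : int).

Definition cocycle_pred : {pred C i} := fun x => zdiff C i (i + 1) x == 0.

Lemma cocycle_zmod_closed : zmod_closed cocycle_pred.
Proof.
split=> [|x y]; rewrite !unfold_in ?raddf0 // => /eqP x0 /eqP y0.
by rewrite raddfB x0 y0 subrr.
Qed.

HB.instance Definition _ :=
  GRing.isZmodClosed.Build (C i) cocycle_pred cocycle_zmod_closed.

Record cocycle := Cocycle { cocycle_val :> C i; _ : cocycle_val \in cocycle_pred }.

HB.instance Definition _ := [isSub for cocycle_val].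
HB.instance Definition _ := [Choice of cocycle by <:].
HB.instance Definition _ := [SubChoice_isSubZmodule of cocycle by <:].

Definition coboundary_pred : {pred cocycle} :=
  fun z => `[< exists y : C (i - 1), zdiff C (i - 1) i y = val z >].

Lemma coboundary_zmod_closed : zmod_closed coboundary_pred.
Proof.
split=> [|z z']; rewrite !unfold_in.
  by apply/asboolP; exists 0; rewrite !raddf0.
move=> /asboolP[y Hy] /asboolP[y' Hy']; apply/asboolP; exists (y - y').
by rewrite !raddfB /= Hy Hy'.
Qed.

HB.instance Definition _ :=
  GRing.isZmodClosed.Build cocycle coboundary_pred coboundary_zmod_closed.

Definition cohomology : zmodType := Quotient.quot coboundary_pred.

End Cohomology.

Definition trivial_group (V : zmodType) := forall x : V, x = 0.

Lemma trivial_cohomologyP (C : zcomplex) (i : int) :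
  trivial_group (cohomology C i) <->
  forall x, zdiff C i (i + 1) x = 0 ->
    exists y : C (i - 1), zdiff C (i - 1) i y = x.
Proof.
split=> [H x dx|H q].
  have hx : x \in cocycle_pred (C := C) (i := i) by rewrite unfold_in; apply/eqP.
  have e : (Cocycle hx == 0 %[mod cohomology C i])%qT.
    by rewrite [X in X == _]H [X in _ == X]H.
  move: e; rewrite -Quotient.idealrBE subr0 unfold_in.
  by move/asboolP.
elim/quotW: q => z; have dz : zdiff C i (i + 1) (val z) = 0.
  by have := valP z; rewrite unfold_in => /eqP.
have [y Hy] := H _ dz.
have e : (z == 0 %[mod cohomology C i])%qT.
  by rewrite -Quotient.idealrBE subr0 unfold_in; apply/asboolP; exists y.
by rewrite (eqP e); exact: (raddf0 (\pi_(cohomology C i)%qT)).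
Qed.

Definition acyclic (C : zcomplex) := forall i, trivial_group (cohomology C i).

Record complex (A : abelianCat) := Complex {
  cterm :> int -> A;
  cdiff : forall i j, hom (cterm i) (cterm j);
  cdiff_shape : forall i j, j != i + 1 -> cdiff i j = 0;
  cdiffK : forall i j k, cdiff j k \oc cdiff i j = 0
}.

Section Complexes.
Variable A : abelianCat.
Implicit Types (B M N : A) (C : complex A).

Definition differential C i : hom (C i) (C (i + 1)) := cdiff C i (i + 1).

Section HomFrom.
Variables (B : A) (C : complex A).

Definition hom_from_diff i j : {additive hom B (C i) -> hom B (C j)} :=
  postcomp (cdiff C i j).

Lemma hom_from_shape i j : j != i + 1 -> forall x, hom_from_diff i j x = 0.
Proof. by move=> h x; rewrite /= /postcomp cdiff_shape // comp0m. Qed.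

Lemma hom_from_diffK i j k x : hom_from_diff j k (hom_from_diff i j x) = 0.
Proof. by rewrite /= /postcomp compA cdiffK comp0m. Qed.

Definition hom_from : zcomplex :=
  @ZComplex (fun i => hom B (C i)) hom_from_diff hom_from_shape hom_from_diffK.

End HomFrom.

(* Hom(C, B) has Hom(C^{-i}, B) in degree i.  No sign is put on its
   differential: cocycles and coboundaries do not depend on it. *)
Section HomTo.
Variables (C : complex A) (B : A).

Definition hom_to_diff i j : {additive hom (C (- i)) B -> hom (C (- j)) B} :=
  precomp (cdiff C (- j) (- i)).

Lemma hom_to_shape i j : j != i + 1 -> forall x, hom_to_diff i j x = 0.
Proof.
move=> h x; rewrite /= /precomp cdiff_shape ?compm0 //.
by apply: contra h => /eqP e; rewrite -[j]opprK -[i]opprK e opprD addrNK.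
Qed.

Lemma hom_to_diffK i j k x : hom_to_diff j k (hom_to_diff i j x) = 0.
Proof. by rewrite /= /precomp -compA cdiffK compm0. Qed.

Definition hom_to : zcomplex :=
  @ZComplex (fun i => hom (C (- i)) B) hom_to_diff hom_to_shape hom_to_diffK.

End HomTo.

(* The complex C with all terms in positive degrees replaced by zero. *)
Section Truncation.
Variable C : complex A.

Definition trunc_sel (b : bool) i : A := if b then C i else zero_obj A.

Definition trunc_sel_diff b c i j : hom (trunc_sel b i) (trunc_sel c j) :=
  match b, c with
  | true, true => cdiff C i j
  | _, _ => 0
  end.

Definition trunc_diff i j := trunc_sel_diff (i <= 0) (j <= 0) i j.

Lemma trunc_shape i j : j != i + 1 -> trunc_diff i j = 0.
Proof.
rewrite /trunc_diff => h.
by case: (i <= 0); case: (j <= 0) => //=; rewrite cdiff_shape.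
Qed.

Lemma trunc_diffK i j k : trunc_diff j k \oc trunc_diff i j = 0.
Proof.
rewrite /trunc_diff.
by case: (i <= 0); case: (j <= 0); case: (k <= 0);
  rewrite /= ?cdiffK ?compm0 ?comp0m.
Qed.

Definition trunc_le0 : complex A :=
  @Complex A (fun i => trunc_sel (i <= 0) i) trunc_diff trunc_shape trunc_diffK.

End Truncation.

Definition right_acyclic (X : subcategory A) C :=
  forall B, X B -> acyclic (hom_from B C).

Definition left_acyclic (Y : subcategory A) C :=
  forall B, Y B -> acyclic (hom_to C B).

Definition right_approximation (X : subcategory A) M B (f : hom B M) :=
  X B /\
  forall B', X B' -> forall g : hom B' M, exists h : hom B' B, f \oc h = g.

Definition left_approximation (Y : subcategory A) N B (f : hom N B) :=
  Y B /\
  forall B', Y B' -> forall g : hom N B', exists h : hom B B', h \oc f = g.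

Definition contravariantly_finite (X : subcategory A) :=
  forall M, exists B (f : hom B M), right_approximation X f.

Definition covariantly_finite (Y : subcategory A) :=
  forall N, exists B (f : hom N B), left_approximation Y f.

(* The (augmented) complex C is ... -> X^{-1} -> X^0 -> M -> 0, with M in
   degree 1. *)
Definition is_resolution (X : subcategory A) M C :=
  [/\ C 1 = M, forall i, i <= 0 -> X (C i), forall i, 1 < i -> is_zero_obj (C i)
    & right_acyclic X C].

(* The (augmented) complex C is 0 -> N -> Y^0 -> Y^1 -> ..., with N in
   degree -1. *)
Definition is_coresolution (Y : subcategory A) N C :=
  [/\ C (- 1) = N, forall i, 0 <= i -> Y (C i),
    forall i, i < - 1 -> is_zero_obj (C i)
    & left_acyclic Y C].

Definition deleted_resolution C : complex A := trunc_le0 C.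

Definition has_resolution_of_length (X : subcategory A) M (n : nat) :=
  exists2 C, is_resolution X M C & forall i, i < - n%:Z -> is_zero_obj (C i).

(* None stands for an infinite dimension. *)
Definition res_dim (X : subcategory A) M : option nat :=
  match pselect (exists n, `[< has_resolution_of_length X M n >]) with
  | left ex => Some (ex_minn ex)
  | right _ => None
  end.

Definition dim_le (d : option nat) (n : nat) : bool :=
  if d is Some m then (m <= n)%N else false.

Record balanced_pair (X Y : subcategory A) : Prop := BalancedPair {
  balanced_contravariantly_finite : contravariantly_finite X;
  balanced_covariantly_finite : covariantly_finite Y;
  balanced_resolution : forall M, exists C,
    is_resolution X M C /\ left_acyclic Y C;
  balanced_coresolution : forall N, exists C,
    is_coresolution Y N C /\ right_acyclic X C
}.

Definition admissible (X Y : subcategory A) (XY : balanced_pair X Y) :=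
  forall M B (f : hom B M), right_approximation X f -> epi f.

Section Ext.
Variables (X Y : subcategory A) (XY : balanced_pair X Y).

(* A chosen X-resolution of M; up to isomorphism Ext does not depend on it. *)
Definition resolution M : complex A :=
  projT1 (cid (balanced_resolution XY M)).

Definition Ext (i : int) M N : zmodType :=
  cohomology (hom_to (deleted_resolution (resolution M)) N) i.

End Ext.

End Complexes.

(* Main.v *)
Require Import Defs.
From mathcomp Require Import all_boot all_algebra.
From mathcomp Require Import all_order boolp zify.
Import Defs.

Set Implicit Arguments.
Unset Strict Implicit.
Unset Printing Implicit Defensive.

Import Order.TTheory GRing.Theory Num.Theory.
Local Open Scope ring_scope.

(** Any two X-resolutions of M are homotopy equivalent over M, because each
    has terms in X and becomes exact under Hom(B, -) for B in X.  Hence the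
    vanishing of the cohomology of Hom(-, N) in a positive degree may be tested
    on any X-resolution of M ([ext_vanishes_transfer]); on one of length at
    most n it is obvious above degree n, so (1) implies (2), and (2) trivially
    implies (3).

    For (3) => (4), let C be an X-resolution and let j : L -> C^{-n} and
    k : K -> C^{-n+1} be the kernels of the differentials.  The differentials
    of C factor through right X-approximations q : C^{-n-1} -> L and
    p : C^{-n} -> K, which are epimorphisms by admissibility.  The map q is a
    cocycle of degree n+1 of Hom(C, L), so it factors through the differential
    C^{-n-1} -> C^{-n}, and this gives a retraction of j.  Hence the exact
    sequence 0 -> L -> C^{-n} -> K -> 0 splits and K is a direct summand of
    C^{-n}, an object of X.

    For (4) => (1), K is in X, so the approximation p splits; replacing
    C^{-n} by K and everything to its left by zero gives an X-resolution of M
    of length n. *)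

(** * Morphisms in preadditive and abelian categories *)

Section Morphisms.
Variable A : preadditiveCat.
Implicit Types B C D : A.

Lemma compBl B C D (g g' : hom C D) (f : hom B C) :
  (g - g') \oc f = g \oc f - g' \oc f.
Proof. exact: comp_zmod_morphism_l. Qed.

Lemma compBr B C D (g : hom C D) (f f' : hom B C) :
  g \oc (f - f') = g \oc f - g \oc f'.
Proof. exact: comp_zmod_morphism_r. Qed.

Lemma kernel_mono B C K (f : hom B C) (k : hom K B) : is_kernel f k -> mono k.
Proof.
move=> [fk ker] D u v e.
have [w [_ uniq]] := ker D (k \oc u) ltac:(by rewrite compA fk comp0m).
by rewrite -(uniq u) // -(uniq v).
Qed.

Lemma kernel_factor B C K (f : hom B C) (k : hom K B) : is_kernel f k ->
  forall D (u : hom D B), f \oc u = 0 -> exists v : hom D K, k \oc v = u.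
Proof. by move=> [_ ker] D u /ker[v [kv _]]; exists v. Qed.

Lemma zero_obj_mor_eq0 B C (f : hom B C) : is_zero_obj B -> f = 0.
Proof. by case=> _; apply. Qed.

Lemma mor_zero_obj_eq0 B C (f : hom B C) : is_zero_obj C -> f = 0.
Proof. by case=> + _; apply. Qed.

End Morphisms.

(** In an abelian category, an epimorphism is the cokernel of its kernel. *)
Lemma epi_factor (A : abelianCat) (L B K D : A) (j : hom L B) (p : hom B K)
    (u : hom B D) :
  epi p -> is_kernel p j -> u \oc j = 0 -> exists v : hom K D, v \oc p = u.
Proof.
move=> /epi_normal[E [g [pg cok]]] /kernel_factor ker uj.
have [w jw] := ker _ _ pg.
have [v [vp _]] := cok D u ltac:(by rewrite -jw compA uj comp0m).
by exists v.
Qed.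

(** If the kernel j of an epimorphism p has a retraction, the short exact
    sequence splits and the target of p is a direct summand. *)
Lemma retracted_kernel_direct_sum (A : abelianCat) (L B K : A)
    (j : hom L B) (p : hom B K) (r : hom B L) :
  epi p -> is_kernel p j -> r \oc j = idm L -> is_direct_sum K L B.
Proof.
move=> epi_p ker_j rj; have [pj _] := ker_j.
have [|s sp] := @epi_factor _ _ _ _ _ j p (idm B - j \oc r) epi_p ker_j.
  by rewrite compBl comp1m -compA rj compm1 subrr.
exists s, j, p, r; split=> //.
- apply: epi_p; rewrite -compA sp comp1m compBr compm1.
  by rewrite compA pj comp0m subr0.
- apply: epi_p; rewrite -compA sp comp0m compBr compm1.
  by rewrite compA rj comp1m subrr.
- by rewrite sp subrK.
Qed.

(** * Comparison of resolutions *)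

Section Comparison.
Variables (A : abelianCat) (X : subcategory A).
Implicit Types (C D : complex A) (M N : A).

(** Exactness of Hom(B, C) in degree j, with the neighbouring degrees as
    variables so that no transport along equalities of degrees is needed. *)
Lemma right_acyclic_lift C (i j l : int) B (x : hom B (C j)) :
  right_acyclic X C -> X B -> j = i + 1 -> l = j + 1 ->
  cdiff C j l \oc x = 0 -> exists y : hom B (C i), cdiff C i j \oc y = x.
Proof.
move=> acC XB ji -> dx.
have -> : i = j - 1 by rewrite ji addrK.
exact: (proj1 (trivial_cohomologyP _ _) (acC B XB j)) dx.
Qed.

(** Existence of the part in degrees i < j < l of chain maps C -> D and D -> C together
    with a homotopy from their composite to the identity of C. *)
Definition homotopic_at C D (i j l : int) : Prop :=
  exists (a : hom (C j) (D j)) (b : hom (D j) (C j)) (h : hom (C j) (C i))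
    (a' : hom (C l) (D l)) (b' : hom (D l) (C l)) (h' : hom (C l) (C j)),
  [/\ cdiff D j l \oc a = a' \oc cdiff C j l,
      cdiff C j l \oc b = b' \oc cdiff D j l
    & idm (C j) - b \oc a = cdiff C i j \oc h + h' \oc cdiff C j l].

Lemma homotopic_at_step C D M (i0 i j l : int) :
  is_resolution X M C -> is_resolution X M D ->
  i = i0 + 1 -> j = i + 1 -> l = j + 1 -> i <= 0 ->
  homotopic_at C D i j l -> homotopic_at C D i0 i j.
Proof.
move=> [_ XC _ acC] [_ XD _ acD] ei ej el i0le.
move=> [a [b [h [a' [b' [h' [ea eb eh]]]]]]].
have [//||//|//||a1 ea1] :=
  @right_acyclic_lift D i j l (C i) (a \oc cdiff C i j).
- exact: XC.
- by rewrite compA ea -compA cdiffK compm0.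
have [//||//|//||b1 eb1] :=
  @right_acyclic_lift C i j l (D i) (b \oc cdiff D i j).
- exact: XD.
- by rewrite compA eb -compA cdiffK compm0.
have [//||//|//||h1 eh1] := @right_acyclic_lift C i0 i j (C i)
    (idm (C i) - b1 \oc a1 - h \oc cdiff C i j).
- exact: XC.
- rewrite !compBr compm1 !compA eb1 -[b \oc _ \oc a1]compA ea1 compA.
  have -> : cdiff C i j - b \oc a \oc cdiff C i j
          = (idm (C j) - b \oc a) \oc cdiff C i j by rewrite compBl comp1m.
  by rewrite -compBl eh addrC addKr -compA cdiffK compm0.
exists a1, b1, h1, a, b, h; split=> //.
by rewrite eh1 subrK.
Qed.

Lemma eq_obj_retract (B C : A) : B = C ->
  exists (a : hom B C) (b : hom C B), b \oc a = idm B.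
Proof. by move=> ->; exists (idm C), (idm C); rewrite comp1m. Qed.

(** A resolution C of M is, up to homotopy, a retract of any other resolution D
    of M; the induction goes down from degree 1, where both are M. *)
Lemma resolutions_homotopic C D M (i : int) :
  is_resolution X M C -> is_resolution X M D -> i <= 1 ->
  homotopic_at C D (i - 1) i (i + 1).
Proof.
move=> resC resD ile1.
have -> : i = 1 - `|1 - i|%N%:Z by lia.
elim: `|1 - i|%N => {ile1} [|k IHk].
  have [C1 _ zC _] := resC; have [D1 _ zD _] := resD.
  rewrite subr0.
  have [a [b ba]] := eq_obj_retract (etrans C1 (esym D1)).
  exists a, b, 0, 0, 0, 0; split.
  - by rewrite comp0m; apply: mor_zero_obj_eq0; apply: zD.
  - by rewrite comp0m; apply: mor_zero_obj_eq0; apply: zC.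
  - by rewrite ba compm0 comp0m addr0 subrr.
have -> : 1 - k.+1%:Z = 1 - k%:Z - 1 by lia.
rewrite subrK.
apply: (homotopic_at_step resC resD _ _ _ _ IHk); lia.
Qed.

(** * The vanishing of Ext on an arbitrary resolution *)

(** The complex Hom(C, N) is exact at Hom(C^j, N). *)
Definition ext_vanishes C N (j : int) : Prop :=
  forall f : hom (C j) N, f \oc cdiff C (j - 1) j = 0 ->
  exists g : hom (C (j + 1)) N, g \oc cdiff C j (j + 1) = f.

Lemma ext_vanishes_transfer C D M N (j : int) :
  is_resolution X M C -> is_resolution X M D -> j <= 0 ->
  ext_vanishes D N j -> ext_vanishes C N j.
Proof.
move=> resC resD jle0 vanD f fd.
have [a [b [h [a' [b' [h' [ea eb eh]]]]]]] :=
  resolutions_homotopic resC resD (le_trans jle0 ler01).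
have [_ XC _ acC] := resC; have [_ XD _ _] := resD.
(* the cocycle f of C pulls back along b to a cocycle of D *)
have [//|||//||c ec] :=
  @right_acyclic_lift C (j - 1) j (j + 1) (D (j - 1)) (b \oc cdiff D (j - 1) j).
- by apply: XD; lia.
- by rewrite subrK.
- by rewrite compA eb -compA cdiffK compm0.
have [|g eg] := vanD (f \oc b).
  by rewrite -compA -ec compA fd comp0m.
exists (g \oc a' + f \oc h').
rewrite compDl -!compA -ea [g \oc _]compA eg.
have -> : f \oc (h' \oc cdiff C j (j + 1)) = f \oc (idm (C j) - b \oc a).
  by rewrite eh compDr [f \oc (_ \oc h)]compA fd comp0m add0r.
by rewrite compBr compm1 -compA addrC subrK.
Qed.

(** In positive degrees the deleted terms play no role; degree i of Hom(C, N)
    is Hom(C^{-i}, N). *)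
Lemma deleted_cohomologyP C N (i : int) : 1 <= i ->
  trivial_group (cohomology (hom_to (deleted_resolution C) N) i) <->
  ext_vanishes C N (- i).
Proof.
move=> ige1; rewrite trivial_cohomologyP /= /precomp /= /trunc_diff.
have -> : (- (i + 1) <= 0) = true by lia.
have -> : (- i <= 0) = true by lia.
have -> : (- (i - 1) <= 0) = true by lia.
rewrite /ext_vanishes /=.
have -> : - (i + 1) = - i - 1 by lia.
by have -> : - (i - 1) = - i + 1 by lia.
Qed.

End Comparison.

(** * Syzygies of a resolution *)

Section Syzygies.
Variables (A : abelianCat) (X : subcategory A).
Implicit Types (C : complex A) (M : A).

(** The differential of C corestricts to a right X-approximation of the next
    kernel. *)
Lemma syzygy_approximation C (i j l : int) K (k : hom K (C j)) :
  right_acyclic X C -> X (C i) -> j = i + 1 -> l = j + 1 ->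
  is_kernel (cdiff C j l) k ->
  exists p : hom (C i) K, k \oc p = cdiff C i j /\ right_approximation X p.
Proof.
move=> acC XCi ej el ker_k.
have [p kp] := kernel_factor ker_k (cdiffK C i j l).
exists p; split=> //; split=> // B XB g.
have [|y dy] := right_acyclic_lift (x := k \oc g) acC XB ej el.
  by case: ker_k => dk _; rewrite compA dk comp0m.
by exists y; apply: (kernel_mono ker_k); rewrite compA kp.
Qed.

(** If Hom(C, -) has no cohomology at Hom(C^h, -), then the kernel K of
    C^j -> C^l is a direct summand of C^i, where h, i, j, l are consecutive. *)
Lemma syzygy_in_subcat C (h i j l : int) K (k : hom K (C j)) :
  (forall B D (f : hom D B), right_approximation X f -> epi f) ->
  right_acyclic X C -> X (C h) -> X (C i) ->
  i = h + 1 -> j = i + 1 -> l = j + 1 ->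
  (forall N, ext_vanishes C N h) -> is_kernel (cdiff C j l) k -> X K.
Proof.
move=> app_epi acC XCh XCi ei ej el van ker_k.
have [p [kp app_p]] := syzygy_approximation acC XCi ej el ker_k.
have [L [j0 ker_j0]] := kernel_ex (cdiff C i j).
have [q [j0q app_q]] := syzygy_approximation acC XCh ei ej ker_j0.
have epi_q := app_epi _ _ _ app_q.
(* q is a cocycle, hence a coboundary, which yields a retraction of j0 *)
have [|r rq] : q \oc cdiff C (h - 1) h = 0 ->
    exists r : hom (C i) L, r \oc cdiff C h i = q.
  by rewrite ei; apply: van.
  by apply: (kernel_mono ker_j0); rewrite compA j0q cdiffK compm0.
rewrite -j0q compA in rq.
have ker_p : is_kernel p j0.
  have [dj0 univ] := ker_j0; split.
    by apply: (kernel_mono ker_k); rewrite compA kp dj0 compm0.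
  by move=> D u pu; apply: univ; rewrite -kp -compA pu compm0.
apply: (subcat_summand _ XCi).
apply: (retracted_kernel_direct_sum (app_epi _ _ _ app_p) ker_p (r := r)).
by apply: epi_q; rewrite rq comp1m.
Qed.

End Syzygies.

(** * Cutting a resolution at a syzygy *)

Section Cut.
Variables (A : abelianCat) (C : complex A) (m : int) (K : A) (s : hom K (C m)).

(** The term in degree i of the complex [cut] below, and its differential; the
    booleans decide whether i is above m, and whether it is m. *)
Definition cut_sel (b c : bool) (i : int) : A :=
  if b then C i else if c then K else zero_obj A.

Definition cut_sel_diff (b c b' c' : bool) (i j : int) :
    hom (cut_sel b c i) (cut_sel b' c' j) :=
  match b, c, b', c' with
  | true, _, true, _ => cdiff C i j
  | false, true, true, _ => cdiff C m j \oc s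
  | _, _, _, _ => 0
  end.

Definition cut_diff (i j : int) :=
  cut_sel_diff (m < i) (i == m) (m < j) (j == m) i j.

Lemma cut_shape i j : j != i + 1 -> cut_diff i j = 0.
Proof.
rewrite /cut_diff => ij; case: (m < i); case: eqP => [e|_]; case: (m < j);
  by case: (j == m); rewrite //= ?cdiff_shape ?comp0m -?e.
Qed.

Lemma cut_diffK i j l : cut_diff j l \oc cut_diff i j = 0.
Proof.
rewrite /cut_diff.
case: (m < i); case: (i == m); case: (m < j); case: (j == m); case: (m < l);
  case: (l == m); by rewrite //= ?compA ?cdiffK ?comp0m ?compm0.
Qed.

(** The complex 0 -> K -> C^{m+1} -> C^{m+2} -> ..., with K in degree m and
    the map from K given by the composite of s with the differential.  Going
    through C^m makes this map available for every target degree at once. *)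
Definition cut : complex A :=
  @Complex A (fun i => cut_sel (m < i) (i == m) i) cut_diff cut_shape cut_diffK.

Lemma cut_gt i : m < i -> cut i = C i.
Proof. by rewrite /= => ->. Qed.

Lemma cut_at : cut m = K.
Proof. by rewrite /cut /= ltxx eqxx. Qed.

Lemma zero_objP : is_zero_obj (zero_obj A).
Proof. exact: projT2 (cid (zero_obj_ex A)). Qed.

Lemma cut_lt i : i < m -> is_zero_obj (cut i).
Proof.
move=> im; rewrite /cut /=.
have -> : (m < i) = false by lia.
have -> : (i == m) = false by lia.
exact: zero_objP.
Qed.

Lemma cut_right_acyclic (X : subcategory A) :
  right_acyclic X C ->
  is_kernel (cdiff C (m + 1) (m + 2)) (cdiff C m (m + 1) \oc s) ->
  right_acyclic X cut.
Proof.
move=> acC ker_k B XB i; apply/trivial_cohomologyP.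
rewrite /= /postcomp /= /cut_diff.
have [im|im|->] := ltgtP i m.
- move=> x _; exists 0; rewrite compm0; apply/esym/mor_zero_obj_eq0.
  exact: zero_objP.
- have -> : (m < i + 1) = true by lia.
  have [im'|im'|em] := ltgtP m (i - 1).
  + move=> x /= dx.
    by apply: right_acyclic_lift acC XB _ _ dx; rewrite ?subrK.
  + lia.
  + have -> : i = m + 1 by lia.
    move=> x /=.
    have -> : m + 1 + 1 = m + 2 by lia.
    exact: kernel_factor ker_k _ x.
- have -> : (m < m + 1) = true by lia.
  move=> x /= kx; exists 0; rewrite compm0.
  by apply/esym/(kernel_mono ker_k); rewrite kx compm0.
Qed.

End Cut.

(** * Resolution dimension *)

Section Dimension.
Variables (A : abelianCat) (X : subcategory A).

Lemma res_dim_leP (M : A) (n : nat) :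
  dim_le (res_dim X M) n <-> has_resolution_of_length X M n.
Proof.
rewrite /res_dim; case: pselect => [ex|nex] /=; last first.
  by split=> // res; case: nex; exists n; apply/asboolP.
case: ex_minnP => m /asboolP[C resC zC] min_m; split=> [mn|res].
  by exists C => // i lti; apply: zC; lia.
by apply/min_m/asboolP.
Qed.

(** If the n-th syzygy of a resolution lies in X, the resolution may be cut
    there. *)
Lemma resolution_cut (C : complex A) (M : A) (n : nat) K
    (k : hom K (C (- n%:Z + 1))) :
  is_resolution X M C -> X K ->
  is_kernel (cdiff C (- n%:Z + 1) (- n%:Z + 2)) k ->
  has_resolution_of_length X M n.
Proof.
move=> [C1 XC zC acC] XK ker_k.
have [|//||p [kp [_ app_p]]] :=
    @syzygy_approximation _ X C (- n%:Z) _ (- n%:Z + 2) _ _ acC _ _ _ ker_k.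
- by apply: XC; lia.
- lia.
(* K is in X, so the approximation p of K has a section s *)
have [s ps] := app_p _ XK (idm K).
have ek : cdiff C (- n%:Z) (- n%:Z + 1) \oc s = k by rewrite -kp -compA ps compm1.
exists (cut s); last by move=> i; apply: cut_lt.
split.
- by rewrite cut_gt //; lia.
- move=> i ile0; have [im|im|->] := ltgtP i (- n%:Z).
  + exact/subcat_zero/cut_lt.
  + by rewrite cut_gt //; apply: XC.
  + by rewrite cut_at.
- by move=> i igt1; rewrite cut_gt; [apply: zC | lia].
- by apply: cut_right_acyclic; rewrite ?ek.
Qed.

End Dimension.

Theorem theorem4p7 (A : abelianCat) (X Y : subcategory A)
    (XY : balanced_pair X Y) (adm : admissible XY) (M : A) (n : nat) :
  [<-> dim_le (res_dim X M) n;
       forall (i : int) (N : A), n%:Z + 1 <= i -> trivial_group (Ext XY i M N);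
       forall N : A, trivial_group (Ext XY (n%:Z + 1) M N);
       forall C : complex A, is_resolution X M C ->
         X (Ker (differential C (- n%:Z + 1)))].
Proof.
have [resR _] : is_resolution X M (resolution XY M)
    /\ left_acyclic Y (resolution XY M).
  exact: projT2 (cid (balanced_resolution XY M)).
have KerP (B C : A) (f : hom B C) : exists k : hom (Ker f) B, is_kernel f k.
  exact: projT2 (cid (kernel_ex f)).
tfae.
- move=> /res_dim_leP[C resC zC] i N lei.
  apply/deleted_cohomologyP; first lia.
  apply: (ext_vanishes_transfer resR resC); first lia.
  move=> f _; exists 0; rewrite comp0m.
  by apply/esym/zero_obj_mor_eq0/zC; lia.
- by move=> van N; apply: van.
- move=> van C resC; have [_ XC _ acC] := resC.
  have [k ker_k] := KerP _ _ (differential C (- n%:Z + 1)).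
  apply: (@syzygy_in_subcat _ X C (- (n%:Z + 1)) (- n%:Z) _ _ _ k adm acC
           _ _ _ _ _ _ ker_k); try lia.
  + by apply: XC; lia.
  + by apply: XC; lia.
  + move=> N; apply: (ext_vanishes_transfer resC resR); first lia.
    by apply/deleted_cohomologyP; [lia | exact: van].
- move=> /(_ _ resR) XK; apply/res_dim_leP.
  have [k ker_k] := KerP _ _ (differential (resolution XY M) (- n%:Z + 1)).
  apply: (resolution_cut resR XK (k := k)).
  by have -> : - n%:Z + 2 = - n%:Z + 1 + 1 by lia.
Qed.
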